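(* Let $d\ge1$ be an integer, let $E<0$, and let $\Omega\subset\mathbb{R}^d$ be a bounded domain (open connected set) with $0\in\Omega$. Assume that there is $C>0$ such that $$|u_E(x)|\le Ce^{-\rho_\Omega(x)}\quad\text{for any }x\in\mathbb{Z}^d.$$ Then $\Omega\subset K^E$.
   Context: $u_E\in\ell^2(\mathbb{Z}^d)$ is defined by $$u_E(x)=(2\pi)^{-d}\int_{\mathbb{T}^d}\Bigl(4\sum_{j=1}^d\sin^2\tfrac{\xi_j}{2}+|E|\Bigr)^{-1}e^{-i\langle x,\xi\rangle}\,d\xi,\qquad x\in\mathbb{Z}^d,$$ where $\mathbb{T}^d=\mathbb{R}^d/2\pi\mathbb{Z}^d$. Also $$\rho_\Omega(x)=\sup_{\xi\in\Omega}\langle x,\xi\rangle,\qquad K^E=\Bigl\{\xi\in\mathbb{R}^d\Bigm|4\sum_{j=1}^d\sinh^2\tfrac{\xi_j}{2}\le|E|\Bigr\}.$$ *)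

(* Defs.v *)
From HB Require Import structures.
From mathcomp Require Import all_boot all_order all_algebra.
From mathcomp Require Import complex.
From mathcomp Require Import all_classical all_reals all_analysis.
From mathcomp Require Import measurable_realfun.

Set Implicit Arguments.
Unset Strict Implicit.
Unset Printing Implicit Defensive.

Import Order.TTheory GRing.Theory Num.Theory.
Import numFieldNormedType.Exports.

Local Open Scope classical_set_scope.
Local Open Scope ring_scope.

(* Lebesgue measure on R^n, with R^n modelled by the measurable type of
   n-tuples: the point mass for n = 0, and the image of the product measure
   under R * R^n -> R^(n+1) otherwise. *)
Section lebesgue_tuple.
Context {R : realType}.
Local Notation mR := (measurableTypeR R).

Definition tcons n (p : mR * n.-tuple mR) : n.+1.-tuple mR :=
  [tuple of p.1 :: p.2].

Lemma measurable_tcons n : measurable_fun [set: mR * n.-tuple mR] (@tcons n).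
Proof. exact: measurable_cons measurable_fst measurable_snd. Qed.

Definition tuncons n (t : n.+1.-tuple mR) : mR * n.-tuple mR :=
  (thead t, [tuple of behead t]).

Lemma measurable_tuncons n : measurable_fun [set: n.+1.-tuple mR] (@tuncons n).
Proof.
apply/measurable_fun_pair; first exact: measurable_tnth.
exact: measurable_behead.
Qed.

Lemma tconsK n : cancel (@tcons n) (@tuncons n).
Proof. by case=> x t; rewrite /tuncons theadE; congr pair; exact/val_inj. Qed.

Section step.
Variables (n : nat) (mu : {sigma_finite_measure set (n.-tuple mR) -> \bar R}).

Definition lebesgue_tupleS : set (n.+1.-tuple mR) -> \bar R :=
  pushforward (lebesgue_measure \x mu)%E (@tcons n).

(* The measure structure of a pushforward depends on a measurability proof, so
   it is not inferred. *)
HB.instance Definition _ := Measure.copy lebesgue_tupleS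
  (measure_function_pushforward__canonical__measure_function_Measure
    (lebesgue_measure \x mu)%E (@measurable_tcons n)).

Let lebesgue_tupleS_sigma_finite : sigma_finite setT lebesgue_tupleS.
Proof.
have /sigma_finiteP[F [TF ndF Foo]] := sigma_finiteT (@lebesgue_measure R).
have /sigma_finiteP[G [TG ndG Goo]] := sigma_finiteT mu.
exists (fun k => @tuncons n @^-1` (F k `*` G k)).
  rewrite -preimage_bigcup (_ : \bigcup_i _ = setT) ?preimage_setT//.
  rewrite -subTset => -[x y] _.
  have [i _ Fix] : (\bigcup_i F i) x by rewrite -TF.
  have [j _ Gjy] : (\bigcup_i G i) y by rewrite -TG.
  exists (maxn i j) => //; split.
  - by move: x Fix; exact/subsetPset/ndF/leq_maxl.
  - by move: y Gjy; exact/subsetPset/ndG/leq_maxr.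
move=> k; have [mF Fk] := Foo k; have [mG Gk] := Goo k; split.
  rewrite -[X in measurable X]setTI.
  by apply: measurable_tuncons => //; exact: measurableX.
rewrite /lebesgue_tupleS /pushforward -comp_preimage.
rewrite (_ : _ \o _ = id); last by apply/funext => p /=; rewrite tconsK.
by rewrite preimage_id product_measure1E// lte_mul_pinfty// ge0_fin_numE.
Qed.

HB.instance Definition _ := Measure_isSigmaFinite.Build _ _ _ lebesgue_tupleS
  lebesgue_tupleS_sigma_finite.

End step.

Fixpoint lebesgue_tuple n : {sigma_finite_measure set (n.-tuple mR) -> \bar R} :=
  match n with
  | 0 => @dirac _ (0.-tuple mR) [tuple] R
  | m.+1 => lebesgue_tupleS (lebesgue_tuple m)
  end.

End lebesgue_tuple.

Local Open Scope complex_scope.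
Local Open Scope ring_scope.

Section green.
Context {R : realType} (d : nat).

Definition dot (x xi : 'rV[R]_d) : R := \sum_(j < d) x 0 j * xi 0 j.

Definition lattice_pt (x : 'rV[int]_d) : 'rV[R]_d := map_mx intr x.

Definition row_of_tuple (t : d.-tuple (measurableTypeR R)) : 'rV[R]_d :=
  \row_j tnth t j.

Definition sinh (x : R) : R := (expR x - expR (- x)) / 2.

Definition expi (x : R) : R[i] := cos x +i* sin x.

Definition Cintegral (D : set (d.-tuple (measurableTypeR R)))
    (f : d.-tuple (measurableTypeR R) -> R[i]) : R[i] :=
  (\int[lebesgue_tuple d]_(t in D) complex.Re (f t)) +i*
  (\int[lebesgue_tuple d]_(t in D) complex.Im (f t)).

(* A fundamental domain of R^d / (2 pi Z)^d, up to a null set; integrands on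
   the torus are 2 pi-periodic functions on R^d. *)
Definition torus : set (d.-tuple (measurableTypeR R)) :=
  [set t | forall j, - pi <= tnth t j <= pi].

Definition green (E : R) (x : 'rV[int]_d) : R[i] :=
  ((2 * pi) ^- d)%:C *
  Cintegral torus (fun t => let xi := row_of_tuple t in
    (4 * \sum_(j < d) sin (xi 0 j / 2) ^+ 2 + `|E|)^-1%:C
      * expi (- dot (lattice_pt x) xi)).

(* [sup] is the genuine supremum only for Omega nonempty and bounded. *)
Definition support_fun (Omega : set 'rV[R]_d) (x : 'rV[R]_d) : R :=
  sup [set dot x xi | xi in Omega].

Definition K_set (E : R) : set 'rV[R]_d :=
  [set xi : 'rV[R]_d | 4 * \sum_(j < d) sinh (xi 0 j / 2) ^+ 2 <= `|E|].

End green.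

(* Main.v *)
(* If xi lies in Omega but not in K^E, connectedness of Omega gives eta in Omega
   on the level set 4 sum_j sinh^2 (eta_j / 2) = |E|, that is, such that
   x |-> e^<x, eta> is annihilated by the operator -Delta + |E| on Z^d.  Since
   Omega contains a ball around eta, w(x) = u_E(x) e^<x, eta> decays
   exponentially, so the equation (-Delta + |E|) u_E = delta_0 may be summed
   against e^<x, eta> by parts, which yields 1 = 0.  The sums are taken over
   boxes whose side tends to infinity.  Everything is done with the real part of
   u_E, which satisfies the same equation and the same bound. *)
Require Import Defs.
From mathcomp Require Import all_boot all_order all_algebra.
From mathcomp Require Import complex.
From mathcomp Require Import all_classical all_reals all_analysis.
From mathcomp Require Import measurable_realfun ring lra zify.
Set Implicit Arguments.
Unset Strict Implicit.
Unset Printing Implicit Defensive.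
Import Order.TTheory GRing.Theory Num.Theory.
Import numFieldNormedType.Exports.
Local Open Scope classical_set_scope.
Local Open Scope complex_scope.
Local Open Scope ring_scope.

(** * Orthogonality of characters on the torus, by induction on the dimension *)

Section torus_integrals.
Context {R : realType}.
Local Notation torus d := (@torus R d).
Local Notation mu := (@lebesgue_tuple R).

Lemma sin_int_pi (k : int) : sin (k%:~R * pi) = 0 :> R.
Proof.
have sin_nat_pi (n : nat) : sin (n%:R * pi) = 0 :> R.
  elim: n => [|n IHn]; first by rewrite mul0r sin0.
  by rewrite -natr1 mulrDl mul1r sinDpi IHn oppr0.
case: k => n; first exact: sin_nat_pi.
by rewrite NegzE intrN mulNr sinN sin_nat_pi oppr0.
Qed.

(** The offset [a] is arbitrary so that the induction on the dimension can put the phase of the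
    other coordinates into it. For [k != 0] the antiderivative [sin (a + k u) / k] takes equal
    values at the two ends, since [sin (k pi) = 0]. *)
Lemma integral_cos_period (a : R) (k : int) :
  (\int[lebesgue_measure]_(u in `[(- pi)%R, pi]) (cos (a + k%:~R * u))%:E
   = (if k == 0 then 2 * pi * cos a else 0)%:E)%E.
Proof.
have pi0 : (- pi < pi :> R)%R by rewrite gtrN // pi_gt0.
have [->|k0] := eqVneq k 0.
  under eq_integral do rewrite mul0r addr0.
  rewrite integral_cst //= lebesgue_measure_itv /= lte_fin pi0 -EFinB -EFinM.
  by congr (_%:E); ring.
have k0' : (k%:~R : R) != 0 by rewrite intr_eq0.
have dF (u : R) : is_derive u 1 (fun u : R => sin (a + k%:~R * u) / k%:~R)
                    (cos (a + k%:~R * u)).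
  have da : is_derive u 1 (fun u : R => a + k%:~R * u) k%:~R.
    by apply: is_derive_eq; rewrite add0r mul1r /GRing.scale /= mulr1.
  have := @is_derive1_comp R (@sin R) (fun u : R => a + k%:~R * u) u _ _ _ da.
  move=> /(_ _ (is_derive_sin _)) /= H.
  have := is_deriveZ (k%:~R^-1) H.
  rewrite /GRing.scale /= => H2.
  apply: (is_derive_eq (f' := k%:~R^-1 * (cos (a + k%:~R * u) * k%:~R))).
    rewrite (_ : (fun _ => _) =
      (k%:~R^-1 \*: (sin \o (fun u : R => a + k%:~R * u)))) //.
    by apply/funext => y /=; rewrite mulrC.
  by field.
have cF : continuous (fun u : R => sin (a + k%:~R * u) / k%:~R).
  move=> u; apply: differentiable_continuous; apply/derivable1_diffP.
  by have [] := dF u.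
rewrite (@continuous_FTC2 _ _ (fun u => sin (a + k%:~R * u) / k%:~R)) //.
- rewrite -EFinB; congr (_%:E); rewrite -mulrBl mulrN !sinD sinN cosN sin_int_pi.
  by rewrite oppr0 subrr mul0r.
- apply: continuous_subspaceT => u.
  apply: continuous_comp; last exact: continuous_cos.
  by apply: cvgD; [exact: cvg_cst|apply: cvgM; [exact: cvg_cst|exact: cvg_id]].
- split.
  + by move=> u _; have [] := dF u.
  + exact: cvg_at_right_filter (cF _).
  + exact: cvg_at_left_filter (cF _).
- by move=> u _; rewrite derive1E; have [_ ->] := dF u.
Qed.

Lemma measurable_torus d : measurable (torus d).
Proof.
rewrite (_ : torus d = \bigcap_(j in [set: 'I_d])
    ((fun t => tnth t j) @^-1` `[(- pi)%R, pi])).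
  apply: fin_bigcap_measurable => [//|j _].
  by rewrite -[X in measurable X]setTI; exact: measurable_tnth.
apply/seteqP; split => t /= H j; first by rewrite /= in_itv /=.
by have := H j I; rewrite /= in_itv.
Qed.

Lemma torusS d :
  @tcons R d @^-1` torus d.+1 = `[(- pi)%R, pi] `*` torus d.
Proof.
apply/seteqP; split => [[u t] H|[u t] [/= u_pi t_pi] j].
  split => [|j] /=; first by rewrite in_itv; exact: (H ord0).
  by have := H (lift ord0 j); rewrite /tcons tnthS.
case: (unliftP ord0 j) => [i|] -> /=; last by rewrite in_itv in u_pi.
by rewrite tnthS.
Qed.

Lemma lebesgue_torus_ltoo d : (mu d (torus d) < +oo)%E.
Proof.
elim: d => [|d IHd]; first by rewrite /= diracE; case: (_ \in _); rewrite ltry.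
have := torusS d; rewrite /= /lebesgue_tupleS /pushforward => ->.
rewrite product_measure1E //; last exact: measurable_torus.
apply: lte_mul_pinfty => //.
have /= -> := @lebesgue_measure_itv R `[(- pi)%R, pi].
by rewrite lte_fin gtrN ?pi_gt0 // -EFinB.
Qed.

Lemma bounded_integrable_torus d (f : d.-tuple (measurableTypeR R) -> R) M :
  measurable_fun setT f -> (forall t, `|f t| <= M) ->
  (mu d).-integrable (torus d) (EFin \o f).
Proof.
move=> mf fM; apply: measurable_bounded_integrable.
- exact: measurable_torus.
- exact: lebesgue_torus_ltoo.
- exact: measurable_funTS.
exists M; split; first exact: num_real.
by move=> M' MM' t _; exact: le_trans (fM t) (ltW MM').
Qed.

(** Frequencies are functions on ['I_d] rather than row vectors, so that the tail of [x] is just its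
    composition with [lift ord0]. *)
Definition phase d (x : 'I_d -> int) (t : d.-tuple (measurableTypeR R)) : R :=
  \sum_(j < d) (x j)%:~R * tnth t j.

Lemma measurable_phase d (x : 'I_d -> int) : measurable_fun setT (phase x).
Proof.
apply: measurable_sum => j; apply: measurable_funM => //.
exact: measurable_tnth.
Qed.

Lemma measurable_cos_phase d (x : 'I_d -> int) a :
  measurable_fun setT (fun t => cos (a + phase x t)).
Proof.
apply: (measurableT_comp (continuous_measurable_fun (@continuous_cos R))).
by apply: measurable_funD => //; exact: measurable_phase.
Qed.

(** Change of variables along [tcons], then Fubini; the bound [M] gives integrability because the
    torus has finite measure. *)
Lemma integral_torusS d (f : d.+1.-tuple (measurableTypeR R) -> R) M :
  measurable_fun setT f -> (forall t, `|f t| <= M) ->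
  (\int[mu d.+1]_(t in torus d.+1) (f t)%:E =
   \int[lebesgue_measure]_(u in `[(- pi)%R, pi])
     \int[mu d]_(s in torus d) (f (tcons (u, s)))%:E)%E.
Proof.
move=> mf fM.
have mD : measurable (@tcons R d @^-1` torus d.+1).
  rewrite -[X in measurable X]setTI.
  by apply: measurable_tcons => //; exact: measurable_torus.
have intf : (lebesgue_measure \x mu d)%E.-integrable (@tcons R d @^-1` torus d.+1)
    ((EFin \o f) \o @tcons R d).
  apply: (@measurable_bounded_integrable _ _ _ _ (f \o @tcons R d)) => //.
  - exact: (lebesgue_torus_ltoo d.+1).
  - by apply: measurable_funTS; exact: measurableT_comp mf (@measurable_tcons R d).
  exists M; split; first exact: num_real.
  by move=> M' MM' t _; exact: le_trans (fM _) (ltW MM').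
have -> := integral_pushforward (measurable_tcons (n := d)) (f := EFin \o f) _ intf.
- rewrite integral_mkcond -integral12_prod_meas1; last first.
    by apply/(integrable_mkcond _ mD).
  rewrite [RHS]integral_mkcond.
  apply: eq_integral => u _; rewrite /fubini_F patchE.
  case: ifPn => uI; last first.
    apply: integral0_eq => s _; rewrite patchE memNset //.
    by rewrite torusS => -[/= uI' _]; case/negP: uI; exact/mem_set.
  rewrite [RHS]integral_mkcond; apply: eq_integral => s _; rewrite !patchE /=.
  congr (if _ then _ else _); rewrite torusS /=.
  apply/idP/idP => /set_mem => [[_ /=]|] ?; apply/mem_set => //.
  by split => //=; exact: set_mem.
- exact/measurable_EFinP.
- exact: measurable_torus.
Qed.

(** Induction on [d]: with the first coordinate [u] fixed, [x ord0 * u] joins the offset of the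
    remaining phase, and the outer integral is [integral_cos_period]. *)
Lemma integral_cos_phase d (x : 'I_d -> int) a :
  (\int[mu d]_(t in torus d) (cos (a + phase x t))%:E
   = (if [forall j, x j == 0%R] then (2 * pi) ^+ d * cos a else 0)%:E)%E.
Proof.
elim: d x a => [|d IHd] x a.
  have -> : [forall j, x j == 0] by apply/forallP => -[].
  rewrite /= integral_dirac //; first last.
  + by apply/measurable_EFinP; apply: measurable_funTS; exact: measurable_cos_phase.
  + exact: measurable_torus.
  rewrite diracE mem_set ?mul1e ?expr0 ?mul1r /phase ?big_ord0 ?addr0 //.
  by case.
rewrite (@integral_torusS _ _ 1); first last.
- by move=> t; exact: cos_max.
- exact: measurable_cos_phase.
have phaseS u t : phase x (tcons (u, t)) =
    (x ord0)%:~R * u + phase (fun j => x (lift ord0 j)) t.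
  rewrite /phase big_ord_recl; congr (_ + _).
  by apply: eq_bigr => j _; rewrite tnthS.
under eq_integral => u _.
  under eq_integral => t _ do rewrite phaseS addrA.
  rewrite IHd; over.
have -> : [forall j, x j == 0] = (x ord0 == 0) && [forall j, x (lift ord0 j) == 0].
  apply/forallP/andP => [x0|[x0 /forallP x0'] j]; first by split => //; exact/forallP.
  by case: (unliftP ord0 j) => [i|] ->.
case: [forall j, x (lift ord0 j) == 0]; last by rewrite andbF integral0.
rewrite andbT; under eq_integral do rewrite EFinM.
rewrite integralZl //; last first.
  apply: continuous_compact_integrable; first exact: segment_compact.
  apply: continuous_subspaceT => u.
  apply: continuous_comp; last exact: continuous_cos.
  by apply: cvgD; [exact: cvg_cst|apply: cvgM; [exact: cvg_cst|exact: cvg_id]].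
rewrite integral_cos_period -EFinM; congr (_%:E).
by case: ifP => _; rewrite ?mulr0 // exprS; ring.
Qed.

Lemma Rintegral_cos_phase d (x : 'I_d -> int) :
  \int[mu d]_(t in torus d) cos (phase x t)
    = if [forall j, x j == 0%R] then (2 * pi) ^+ d else 0.
Proof.
have /(congr1 fine) := integral_cos_phase x 0.
rewrite /= cos0 mulr1 => <-; congr fine; apply: eq_integral => t _.
by rewrite add0r.
Qed.

Lemma phaseD d (x y : 'I_d -> int) t :
  phase (fun j => x j + y j) t = phase x t + phase y t.
Proof.
by rewrite -big_split; apply: eq_bigr => j _; rewrite intrD mulrDl.
Qed.

Lemma phase_delta d (i : 'I_d) (a : int) t :
  phase (fun j => if j == i then a else 0) t = a%:~R * tnth t i.
Proof.
rewrite /phase (bigD1 i) //= eqxx big1 ?addr0 // => j /negbTE ->.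
by rewrite mul0r.
Qed.

(** * The Fourier multiplier of -Delta + |E| and the difference equation for the real part of u_E *)

Definition symbol d (E : R) (t : d.-tuple (measurableTypeR R)) : R :=
  4 * \sum_(j < d) sin (tnth t j / 2) ^+ 2 + `|E|.

Lemma symbol_ge d E (t : d.-tuple (measurableTypeR R)) : `|E| <= symbol E t.
Proof.
by rewrite lerDr mulr_ge0 // sumr_ge0 // => j _; exact: sqr_ge0.
Qed.

Lemma measurable_symbol d E : measurable_fun setT (@symbol d E).
Proof.
apply: measurable_funD => //; apply: measurable_funM => //.
apply: measurable_sum => j; apply: measurable_funX.
apply: (measurableT_comp (continuous_measurable_fun (@continuous_sin R))).
by apply: measurable_funM => //; exact: measurable_tnth.
Qed.

Definition green_integrand d E (x : 'I_d -> int) t : R :=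
  (symbol E t)^-1 * cos (phase x t).

Lemma green_integrand_le d E (x : 'I_d -> int) t : E < 0 ->
  `|green_integrand E x t| <= `|E|^-1.
Proof.
move=> E0; have E0' : 0 < `|E| by rewrite normr_gt0 lt_eqF.
have S0 := lt_le_trans E0' (symbol_ge E t).
rewrite normrM normfV (gtr0_norm S0) -[leRHS]mulr1.
by apply: ler_pM; rewrite ?invr_ge0 ?(ltW S0) ?cos_max // lef_pV2 ?posrE ?symbol_ge.
Qed.

Lemma integrable_green_integrand d E (x : 'I_d -> int) : E < 0 ->
  (mu d).-integrable (torus d) (EFin \o green_integrand E x).
Proof.
move=> E0; apply: (@bounded_integrable_torus _ _ `|E|^-1); last first.
  by move=> t; exact: green_integrand_le.
apply: measurable_funM; last first.
  rewrite (_ : (fun t => _) = (fun t => cos (0 + phase x t))).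
    exact: measurable_cos_phase.
  by apply/funext => t; rewrite add0r.
(* Measurability of the inverse is read off from the real power -1, which agrees with it because the
   symbol is nonnegative. *)
rewrite (_ : (fun t => _) = (fun t => symbol E t `^ (-1))).
  exact: (measurableT_comp (measurable_powR (-1)) (@measurable_symbol d E)).
by apply/funext => t; rewrite powR_inv1 // (le_trans _ (symbol_ge E t)).
Qed.

Lemma Rintegral_sum d (I : Type) (s : seq I)
    (f : I -> d.-tuple (measurableTypeR R) -> R) :
  (forall i, (mu d).-integrable (torus d) (EFin \o f i)) ->
  \int[mu d]_(t in torus d) (\sum_(i <- s) f i t)
    = \sum_(i <- s) \int[mu d]_(t in torus d) f i t.
Proof.
move=> intf; elim: s => [|i s IHs].
  under eq_Rintegral do rewrite big_nil.
  by rewrite big_nil Rintegral_cst ?mul0r //; exact: measurable_torus.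
rewrite big_cons -IHs -RintegralD //; last first.
- have -> : EFin \o (fun t => \sum_(i <- s) f i t)
      = (fun t => \sum_(i <- s) (f i t)%:E)%E.
    by apply/funext => t /=; rewrite sumEFin.
  by apply: integrable_sum => [|k _]; [exact: measurable_torus|exact: intf].
- exact: measurable_torus.
by apply: eq_Rintegral => t _; rewrite big_cons.
Qed.

Lemma Re_green d E (x : 'rV[int]_d) :
  complex.Re (green (R := R) E x) = (2 * pi) ^- d
    * \int[mu d]_(t in torus d) green_integrand E (fun j => x 0 j) t.
Proof.
rewrite /green /Cintegral /= mul0r subr0; congr (_ * _).
apply: eq_Rintegral => t _.
rewrite /green_integrand /expi /= mul0r subr0 cosN; congr (_ * cos _).
  by congr (_ * _ + _)^-1; apply: eq_bigr => j _; rewrite mxE.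
by apply: eq_bigr => j _; rewrite !mxE.
Qed.

(** Under the integral sign, the second differences together with [|E|] multiply the integrand by
    [symbol E]. This cancels its inverse and leaves the integral of a pure cosine, which
    orthogonality evaluates. *)
Lemma Re_green_eq d E (x : 'rV[int]_d) : E < 0 ->
  let u y := complex.Re (green (R := R) E y) in
  \sum_j (2 * u x - u (x + delta_mx 0 j) - u (x - delta_mx 0 j)) + `|E| * u x
    = (x == 0)%:R.
Proof.
move=> E0 u.
pose g y t := green_integrand E (fun j : 'I_d => (y : 'rV[int]_d) 0 j) t.
have ig y : (mu d).-integrable (torus d) (EFin \o g y).
  exact: integrable_green_integrand.
have mT := @measurable_torus d.
have phase_shift y j a t : phase (fun i => (y + a *: delta_mx 0 j : 'rV[int]_d) 0 i) t
    = phase (fun i => y 0 i) t + a%:~R * tnth t j.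
  rewrite -phase_delta -phaseD; apply: eq_bigr => i _; rewrite !mxE /=.
  by case: eqP => _; rewrite ?mulr1 ?mulr0.
pose f j t := 2 * g x t - g (x + delta_mx 0 j) t - g (x - delta_mx 0 j) t.
(* With theta the phase of [x] and [b] the [j]-th coordinate of [t]: cos (theta + b) + cos (theta -
   b) = 2 cos theta cos b, and 1 - cos b = 2 sin^2 (b / 2). *)
have fE j t : f j t = 4 * sin (tnth t j / 2) ^+ 2 * g x t.
  rewrite /f /g /green_integrand -{1}(scale1r (delta_mx 0 j)).
  rewrite -(scaleN1r (delta_mx 0 j)) !phase_shift.
  rewrite intrN !mulr1z mul1r mulN1r cosB cosD.
  set b := tnth t j; have -> : cos b = 1 - 2 * sin (b / 2) ^+ 2.
    have {1}-> : b = (b / 2) *+ 2 by rewrite -mulr_natr; field.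
    by rewrite cos_mulr2n; have := cos2Dsin2 (b / 2); lra.
  by ring.
have intf j : (mu d).-integrable (torus d) (EFin \o f j).
  exact: (integrableB mT (integrableB mT (integrableZl mT 2 (ig x)) (ig _)) (ig _)).
have int_f j : \int[mu d]_(t in torus d) f j t = 2 * \int[mu d]_(t in torus d) g x t
    - \int[mu d]_(t in torus d) g (x + delta_mx 0 j) t
    - \int[mu d]_(t in torus d) g (x - delta_mx 0 j) t.
  rewrite RintegralB //; last exact: (integrableB mT (integrableZl mT 2 (ig x)) (ig _)).
  by rewrite RintegralB ?RintegralZl //; exact: (integrableZl mT 2 (ig x)).
transitivity ((2 * pi) ^- d * (\sum_j \int[mu d]_(t in torus d) f j t
    + `|E| * \int[mu d]_(t in torus d) g x t)).
  have uE y : u y = (2 * pi) ^- d * \int[mu d]_(t in torus d) g y t := Re_green E y.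
  rewrite [RHS]mulrDr mulr_sumr uE; congr (_ + _); last by rewrite mulrCA.
  by apply: eq_bigr => j _; rewrite !uE int_f; ring.
rewrite -Rintegral_sum // -RintegralZl // -RintegralD //; last 2 first.
- have -> : EFin \o (fun t => \sum_j f j t) = (fun t => \sum_j (f j t)%:E)%E.
    by apply/funext => t /=; rewrite sumEFin.
  by apply: integrable_sum => // j _; exact: intf.
- exact: (integrableZl mT `|E| (ig x)).
rewrite (_ : Rintegral _ _ _ = if [forall j, x 0 j == 0] then (2 * pi) ^+ d else 0).
  have -> : [forall j, x 0 j == 0] = (x == 0).
    apply/forallP/eqP => [x0|-> j]; last by rewrite mxE.
    by apply/rowP => j; rewrite mxE; exact/eqP.
  case: eqP => _; last by rewrite mulr0.
  by rewrite mulVf // expf_neq0 // mulf_neq0 // gt_eqF // pi_gt0.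
rewrite -Rintegral_cos_phase; apply: eq_Rintegral => t _.
under eq_bigr do rewrite fE.
rewrite -mulr_suml -mulr_sumr -mulrDl -/(symbol E t) /g /green_integrand mulrA.
rewrite mulfV ?mul1r // gt_eqF // (lt_le_trans _ (symbol_ge E t)) //.
by rewrite normr_gt0 lt_eqF.
Qed.

End torus_integrals.

(** * Summation over the boxes [-N, N]^d and the exclusion of decaying solutions *)

Section box_sums.
Context {R : realType} (d : nat).

Definition box N := {ffun 'I_d -> 'I_(N.*2.+1)}.

Definition box_pt N (f : box N) : 'rV[int]_d := \row_j ((f j : nat)%:Z - N%:Z).

Definition unitv (j : 'I_d) : 'rV[int]_d := delta_mx 0 j.

Lemma card_box N : #|{: box N}| = (N.*2.+1 ^ d)%N.
Proof. by rewrite card_ffun !card_ord. Qed.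

(* A cyclic shift permutes the box and agrees with [x |-> x + e_j] except on the
   last face, so the two sums below differ by boundary terms only. *)
Definition box_rot N (j : 'I_d) (f : box N) : box N :=
  [ffun i => if i == j then ordS (f i) else f i].

Lemma box_rot_inj N j : injective (@box_rot N j).
Proof.
move=> f g /ffunP fg; apply/ffunP => i; have := fg i; rewrite !ffunE.
by case: eqP => // _; exact: ordS_inj.
Qed.

Lemma box_pt_rot N j (f : box N) : f j != ord_max ->
  box_pt (box_rot j f) = box_pt f + unitv j.
Proof.
move=> fj; apply/rowP => i; rewrite !mxE !ffunE /=.
case: eqP => [->|_]; last by rewrite addr0.
have fN : ((f j).+1 < N.*2.+1)%N.
  by rewrite ltn_neqAle ltn_ord andbT; apply: contra fj => /eqP[fj]; exact/eqP/val_inj.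
by rewrite /= modn_small // -addn1 PoszD addrAC.
Qed.

(** The bound charges every point of the box, not only those of a face; this loss is harmless
    because [M] will be exponentially small in [N]. *)
Lemma sum_box_shift N (j : 'I_d) (w : 'rV[int]_d -> R) (M : R) :
  (forall x : 'rV[int]_d, x 0 j = N.+1%:Z -> `|w x| <= M) ->
  (forall x : 'rV[int]_d, x 0 j = - N%:Z -> `|w x| <= M) ->
  `|\sum_(f : box N) w (box_pt f + unitv j) - \sum_(f : box N) w (box_pt f)|
    <= (N.*2.+1 ^ d)%:R * (2 * M).
Proof.
move=> wr wl.
rewrite [X in _ - X](reindex_inj (@box_rot_inj N j)) /= -sumrB.
apply: le_trans (ler_norm_sum _ _ _) _.
rewrite -card_box mulr_natl -sumr_const; apply: ler_sum => f _.
have M0 : 0 <= M.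
  by apply: le_trans (normr_ge0 _) (wl (const_mx (- N%:Z)) _); rewrite mxE.
(* Off the last face the two terms cancel. On it, the shifted point has [j]-th coordinate [N + 1]
   and the rotated one wraps around to [- N]. *)
have [fj|fj] := eqVneq (f j) ord_max; last first.
  by rewrite box_pt_rot // subrr normr0 mulr_ge0.
apply: le_trans (ler_normB _ _) _; rewrite mulr_natl mulr2n; apply: lerD.
  by apply: wr; rewrite !mxE !eqxx fj /=; lia.
by apply: wl; rewrite !mxE ffunE eqxx fj /= modnn; lia.
Qed.

Lemma sum_box_delta N : \sum_(f : box N) (box_pt f == 0)%:R = 1 :> R.
Proof.
have N2 : (N < N.*2.+1)%N by lia.
pose f0 : box N := [ffun _ => Ordinal N2].
have f00 : box_pt f0 = 0 by apply/rowP => i; rewrite !mxE ffunE subrr.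
rewrite (bigD1 f0) //= f00 eqxx big1 ?addr0 // => f ff0.
case: eqP => // /rowP f0'; case/negP: ff0; apply/eqP/ffunP => i; apply/val_inj.
by rewrite ffunE /=; have := f0' i; rewrite !mxE; lia.
Qed.

Lemma pow_expR_lt1 (K e : R) : 0 < K -> 0 < e ->
  exists N : nat, K * (N.*2.+1 ^ d)%:R * expR (- (e * N%:R)) < 1.
Proof.
move=> K0 e0.
(* [1 + x <= expR x] gives [2 N + 1 <= B * expR (e N / D)], whose [d]-th power
   costs only half of the decay rate because [d / D <= 1 / 2]. *)
pose D : R := d.*2.+2%:R; pose B := 1 + 2 * D / e.
have D0 : 0 < D by [].
have B1 : 1 <= B by rewrite lerDl mulr_ge0 // ?invr_ge0 ltW // mulr_gt0.
have growth N : (N.*2.+1)%:R <= B * expR (e / D * N%:R).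
  have N0 : 0 <= N%:R :> R by [].
  apply: (@le_trans _ _ (B * (1 + e / D * N%:R))); last first.
    by rewrite ler_wpM2l ?expR_ge1Dx // (le_trans _ B1).
  (* The summand [2 * D / e] of [B] is chosen so that its product with [e / D * N] is exactly
     [2 * N]. *)
  have -> : B * (1 + e / D * N%:R) = 1 + 2 * N%:R + (2 * D / e + e / D * N%:R).
    by rewrite /B; field; rewrite !gt_eqF.
  rewrite -addn1 natrD -muln2 natrM mulrC addrC lerDl.
  by rewrite addr_ge0 // mulr_ge0 // ?mulr_ge0 // ?invr_ge0 ltW.
have powth N : (N.*2.+1 ^ d)%:R * expR (- (e * N%:R))
    <= B ^+ d * expR (- (e / 2 * N%:R)).
  apply: (@le_trans _ _ ((B * expR (e / D * N%:R)) ^+ d * expR (- (e * N%:R)))).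
    rewrite ler_wpM2r ?expR_ge0 // natrX lerXn2r ?nnegrE //.
    by rewrite mulr_ge0 ?expR_ge0 // (le_trans _ B1).
  rewrite exprMn -(mulrA (B ^+ d)) ler_wpM2l ?exprn_ge0 ?(le_trans _ B1) //.
  rewrite -expRM_natl -expRD ler_expR.
  have dD : d%:R / D <= 1 / 2.
    rewrite ler_pdivrMr // /D -[d.*2.+2]addn2 natrD -muln2 natrM; lra.
  have eN : 0 <= e * N%:R by rewrite mulr_ge0 // ltW.
  have -> : d%:R * (e / D * N%:R) = d%:R / D * (e * N%:R) by ring.
  have -> : e / 2 * N%:R = e * N%:R / 2 by ring.
  have := ler_wpM2r eN dD; move: (e * N%:R) => z; move: (d%:R / D * z) => y; lra.
have KB0 : 0 <= K * B ^+ d by rewrite mulr_ge0 ?exprn_ge0 ?(le_trans _ B1) // ltW.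
(* This makes [e / 2 * N] exceed [K * B ^+ d], which suffices since the exponential dominates its
   argument plus one. *)
exists (Num.bound (K * B ^+ d / (e / 2))).
set N := Num.bound _.
apply: (@le_lt_trans _ _ (K * (B ^+ d * expR (- (e / 2 * N%:R))))).
  by rewrite -mulrA ler_wpM2l ?powth // ltW.
rewrite mulrA expRN ltr_pdivrMr ?expR_gt0 // mul1r.
apply: lt_le_trans (expR_ge1Dx _).
have e20 : 0 < e / 2 by rewrite divr_gt0.
have := archi_boundP (divr_ge0 KB0 (ltW e20)).
rewrite -/N ltr_pdivrMr // mulrC; lra.
Qed.

(** The value of [a] makes the coefficients of the tilted operator sum to zero, so summing the
    equation over a box leaves only differences between shifted and unshifted sums. These tend to 0
    with growing [N], whereas the right-hand side sums to 1. *)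
Lemma no_decaying_solution (eta : 'I_d -> R) (a : R) (w : 'rV[int]_d -> R) C e :
  0 < e -> 0 <= C ->
  a = \sum_j (expR (eta j) + expR (- eta j) - 2) ->
  (forall x, \sum_j (2 * w x - expR (- eta j) * w (x + unitv j)
       - expR (eta j) * w (x - unitv j)) + a * w x = (x == 0)%:R) ->
  (forall (x : 'rV[int]_d) j,
     `|w x| <= C * expR (- (e * `|x 0 j|%:~R))) -> False.
Proof.
move=> e0 C0 aE weq wle.
pose E := \sum_j (expR (- eta j) + expR (eta j)).
have E0 : 0 <= E by apply: sumr_ge0 => j _; rewrite addr_ge0 ?expR_ge0.
(* The added 1 keeps the constant positive even if [C = 0]; its contribution is discarded in the
   final estimate. *)
have K0 : 0 < E * (2 * C) + 1 by rewrite ltr_wpDl // !mulr_ge0.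
have [N] := pow_expR_lt1 K0 e0; apply/negP; rewrite -leNgt.
pose M := C * expR (- (e * N%:R)).
have M0 : 0 <= M by rewrite mulr_ge0 ?expR_ge0.
have wM (x : 'rV[int]_d) j : (N%:Z <= `|x 0 j|)%R -> `|w x| <= M.
  move=> xN; apply: le_trans (wle x j) _; rewrite ler_wpM2l // ler_expR lerN2.
  by rewrite ler_wpM2l ?(ltW e0) // -[leLHS]/((N%:Z)%:~R) ler_int.
pose S := \sum_(f : box N) w (box_pt f).
pose P j := \sum_(f : box N) w (box_pt f + unitv j).
pose Q j := \sum_(f : box N) w (box_pt f - unitv j).
have PS j : `|P j - S| <= (N.*2.+1 ^ d)%:R * (2 * M).
  by apply: sum_box_shift => x xj; apply: (wM x j); rewrite xj; lia.
have QS j : `|Q j - S| <= (N.*2.+1 ^ d)%:R * (2 * M).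
  (* The backward shift is the forward one for the translate of [w] by [unitv j]; its boundary
     values lie at [j]-th coordinates [N] and [- N - 1]. *)
  have -> : S = \sum_(f : box N) w (box_pt f + unitv j - unitv j).
    by apply: eq_bigr => f _; rewrite addrK.
  rewrite distrC; apply: (@sum_box_shift N j (fun x => w (x - unitv j))) => x xj;
    by apply: (wM _ j); rewrite !mxE xj /= eqxx /=; lia.
have sum1 : \sum_j (expR (- eta j) * (S - P j) + expR (eta j) * (S - Q j)) = 1.
  rewrite -(sum_box_delta N).
  under [RHS]eq_bigr do rewrite -weq.
  rewrite [RHS]big_split /= -mulr_sumr -/S aE mulr_suml exchange_big /= -big_split /=.
  apply: eq_bigr => j _.
  rewrite !sumrB -!mulr_sumr -/S -/(P j) -/(Q j); ring.
have -> : (E * (2 * C) + 1) * (N.*2.+1 ^ d)%:R * expR (- (e * N%:R))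
    = E * ((N.*2.+1 ^ d)%:R * (2 * M)) + (N.*2.+1 ^ d)%:R * expR (- (e * N%:R)).
  by rewrite /M; ring.
apply: ler_wpDr; first by rewrite mulr_ge0 ?expR_ge0.
rewrite -[leLHS]sum1.
apply: le_trans (ler_norm _) _; apply: le_trans (ler_norm_sum _ _ _) _.
rewrite /E mulr_suml; apply: ler_sum => j _.
apply: le_trans (ler_normD _ _) _; rewrite mulrDl !normrM !(ger0_norm (expR_ge0 _)).
by apply: lerD; rewrite ler_wpM2l ?expR_ge0 // distrC.
Qed.
End box_sums.

(** * Support functions, the level set of the sinh sum, and exponential tilting *)

Section support.
Context {R : realType} (d : nat).
Implicit Types (Omega : set 'rV[R]_d) (x : 'rV[R]_d).

Lemma dot_le_support_fun Omega x xi :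
  bounded_set Omega -> Omega xi -> dot x xi <= support_fun Omega x.
Proof.
(* [bounded_set] provides bounds only strictly above [M], hence [M + 1]. Boundedness makes [sup] an
   actual upper bound here. *)
move=> [M [_ /(_ (M + 1))]]; rewrite ltrDl ltr01 => /(_ isT) OM Oxi.
apply: ub_le_sup; last by exists xi.
exists (\sum_j `|x 0 j| * (M + 1)) => _ [z Oz <-].
apply: ler_sum => j _; apply: le_trans (ler_norm _) _.
rewrite normrM ler_wpM2l //; apply: le_trans _ (OM z Oz).
rewrite [leRHS]mx_normrE.
by apply: (le_bigmax _ (fun ij => `|z ij.1 ij.2|) (0, j)).
Qed.

(** Moving [eta] by [e] along the [j]-th axis, in the direction of the sign of [x 0 j], stays in
    [Omega] and raises the pairing by [e * |x 0 j|]. The same [e] serves all [x] and [j], which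
    yields uniform exponential decay. *)
Lemma support_fun_open_gap Omega eta :
  bounded_set Omega -> open Omega -> Omega eta ->
  exists2 e, 0 < e &
    forall x j, dot x eta + e * `|x 0 j| <= support_fun Omega x.
Proof.
move=> bO oO Oeta.
have /nbhs_ballP[r /= r0 rO] : nbhs eta Omega by exact: open_nbhs_nbhs.
exists (r / 2) => [|x j]; first by rewrite divr_gt0.
pose s := r / 2 * Num.sg (x 0 j).
have -> : dot x eta + r / 2 * `|x 0 j| = dot x (eta + s *: delta_mx 0 j).
  rewrite /dot; under [RHS]eq_bigr do rewrite !mxE mulrDr.
  rewrite big_split /=; congr (_ + _).
  rewrite (bigD1 j) //= !eqxx big1 ?addr0 => [|i /negbTE ->]; last first.
    by rewrite !mulr0.
  by rewrite mulr1 /s normrEsg; ring.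
apply: dot_le_support_fun => //; apply: rO; split => // i k.
rewrite -ball_normE /ball_ /= !mxE opprD addNKr normrN normrM.
(* Balls are taken in the sup norm, so each entry is tested separately, and only entry [j] has
   moved, by at most [r / 2]. *)
apply: (@le_lt_trans _ _ (r / 2)); last lra.
have r20 : 0 < r / 2 by rewrite divr_gt0.
rewrite normrM (gtr0_norm r20) // -mulrA ler_piMr ?(ltW r20) //.
rewrite normr_sg normr_nat -natrM lern1.
by case: (x 0 j != 0); case: (_ && _).
Qed.

Lemma four_sinh2 (t : R) : 4 * sinh (t / 2) ^+ 2 = expR t + expR (- t) - 2.
Proof.
have {2 3}-> : t = t / 2 + t / 2 by field.
rewrite opprD !expRD /sinh.
have := expRxMexpNx_1 (t / 2).
move: (expR (t / 2)) (expR (- (t / 2))) => a b ab.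
have -> : 4 * ((a - b) / 2) ^+ 2 = a * a + b * b - 2 * (a * b) by field.
by rewrite ab mulr1.
Qed.

(** Intermediate value theorem: the continuous image of [Omega] is an interval containing 0, the
    value at the origin, and a value above [|E|], the one at [xi]. *)
Lemma connected_level Omega (E : R) xi :
  connected Omega -> Omega 0 -> Omega xi -> ~ K_set E xi ->
  exists2 eta, Omega eta & 4 * \sum_(j < d) sinh (eta 0 j / 2) ^+ 2 = `|E|.
Proof.
move=> cO O0 Oxi /negP; rewrite -ltNge => Kxi.
pose f (y : 'rV[R]_d) := 4 * \sum_(j < d) sinh (y 0 j / 2) ^+ 2.
have cf : continuous f.
  have csinh : continuous (@sinh R).
    move=> t; apply: cvgM; last exact: cvg_cst.
    apply: cvgB; first exact: continuous_expR.
    apply: (continuous_comp (f := -%R)); last exact: continuous_expR.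
    exact: opp_continuous.
  have csum : continuous (fun z : 'rV[R]_d => \sum_(j < d) sinh (z 0 j / 2) ^+ 2).
    apply: continuous_big => [|j _ y]; first exact: add_continuous.
    apply: (@continuous_comp _ _ _ (fun z : 'rV[R]_d => z 0 j)
      (fun u : R => sinh (u / 2) ^+ 2)); first exact: coord_continuous.
    apply: (@continuous_comp _ _ _ (fun u : R => sinh (u / 2))
      (fun u : R => u ^+ 2)).
      apply: (@continuous_comp _ _ _ (fun u : R => u / 2) (@sinh R));
        last exact: csinh.
      by apply: cvgM; [exact: cvg_id|exact: cvg_cst].
    exact: exprn_continuous.
  move=> y; apply: (@continuous_comp _ _ _
    (fun z : 'rV[R]_d => \sum_(j < d) sinh (z 0 j / 2) ^+ 2)
    (fun u : R => 4 * u)); first exact: csum.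
  by apply: cvgM; [exact: cvg_cst|exact: cvg_id].
have /connected_intervalP fO :=
  connected_continuous_connected cO (continuous_subspaceT cf).
have f0 : f 0 = 0.
  rewrite /f big1 ?mulr0 // => j _.
  by rewrite mxE mul0r /sinh oppr0 subrr mul0r expr0n.
have [|eta Oeta feta] := fO (f 0) (f xi) (imageP f O0) (imageP f Oxi) `|E|.
  by rewrite f0 normr_ge0 ltW.
by exists eta.
Qed.

(** Multiply the equation at [x] by the exponential weight there. A unit step changes the weight by
    [expR] of plus or minus [eta 0 j], and the right-hand side is unchanged because the weight is 1
    at the origin. *)
Lemma tilted_equation (u : 'rV[int]_d -> R) (a : R) (eta : 'rV[R]_d) :
  (forall x : 'rV[int]_d,
     \sum_j (2 * u x - u (x + unitv j) - u (x - unitv j)) + a * u x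
     = (x == 0)%:R) ->
  let w y := u y * expR (dot (lattice_pt y) eta) in
  forall x : 'rV[int]_d, \sum_j (2 * w x - expR (- eta 0 j) * w (x + unitv j)
      - expR (eta 0 j) * w (x - unitv j)) + a * w x = (x == 0)%:R.
Proof.
move=> ueq w x; pose phi (y : 'rV[int]_d) : R := expR (dot (lattice_pt y) eta).
have phiZ y j (b : int) : phi (y + b *: unitv j) = phi y * expR (b%:~R * eta 0 j).
  rewrite /phi -expRD; congr expR; rewrite /dot.
  under eq_bigr do rewrite !mxE intrD mulrDl.
  rewrite big_split /=; congr (_ + _); first by apply: eq_bigr => i _; rewrite mxE.
  rewrite (bigD1 j) //= eqxx mulr1 big1 ?addr0 // => i /negbTE ->.
  by rewrite mulr0 mul0r.
have -> : (x == 0)%:R = (x == 0)%:R * phi x.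
  case: eqP => [->|_]; last by rewrite mul0r.
  by rewrite mul1r /phi /dot big1 ?expR0 // => j _; rewrite !mxE mul0r.
rewrite -ueq [RHS]mulrDl mulr_suml -[in RHS]mulrA; congr (_ + _).
apply: eq_bigr => j _; rewrite /w -!/(phi _).
have -> : phi (x + unitv j) = phi x * expR (eta 0 j).
  by rewrite -{1}(scale1r (unitv j)) phiZ mul1r.
have -> : phi (x - unitv j) = phi x * expR (- eta 0 j).
  by rewrite -(scaleN1r (unitv j)) phiZ intrN mulN1r.
have := expRxMexpNx_1 (eta 0 j).
move: (expR (eta 0 j)) (expR (- eta 0 j)) (u x) (u (x + _)) (u (x - _)) (phi x).
move=> p q u0 u1 u2 f pq.
transitivity (2 * (u0 * f) - u1 * f * (p * q) - u2 * f * (p * q)); first by ring.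
by rewrite pq; ring.
Qed.

End support.

Theorem proposition4p1 (R : realType) (d : nat) (E : R)
    (Omega : set 'rV[R]_d) :
  (1 <= d)%N -> E < 0 ->
  bounded_set Omega -> open Omega -> connected Omega -> Omega 0 ->
  (exists C : R, 0 < C /\ forall x : 'rV[int]_d,
     Normc.normc (green E x) <= C * expR (- support_fun Omega (lattice_pt x))) ->
  Omega `<=` K_set E.
Proof.
move=> _ E0 bO oO cO O0 [C [C0 green_le]] xi Oxi; apply: contrapT => Kxi.
have [eta Oeta levelE] := connected_level cO O0 Oxi Kxi.
have [e e0 gap] := support_fun_open_gap bO oO Oeta.
apply: (no_decaying_solution e0 (ltW C0) (eta := fun j => eta 0 j) (a := `|E|)).
- by rewrite -levelE mulr_sumr; apply: eq_bigr => j _; rewrite four_sinh2.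
- exact: tilted_equation (fun x => Re_green_eq x E0).
move=> x j /=; rewrite normrM (ger0_norm (expR_ge0 _)).
have uC : `|complex.Re (green E x)| <= C * expR (- support_fun Omega (lattice_pt x)).
  apply: le_trans (green_le x); case: (green E x) => a b /=.
  by rewrite -sqrtr_sqr ler_wsqrtr // lerDl sqr_ge0.
apply: le_trans (ler_wpM2r (expR_ge0 _) uC) _.
(* The exponent is now the pairing with [eta] minus the support function, at most [- (e * |x 0 j|)]
   by the gap. *)
rewrite -mulrA -expRD ler_wpM2l ?(ltW C0) // ler_expR.
by have := gap (lattice_pt x) j; rewrite mxE -intr_norm; lra.
Qed.
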